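(* Let $\mathbb K$ be an algebraically closed field of characteristic $p>0$ and $\mathfrak g=\mathfrak{sl}(1|2)$. If $p\neq2$, then $H^1(\mathfrak g;\mathfrak g)=0$ and $H^2(\mathfrak g)=0$. If $p=2$, then $H^1(\mathfrak g;\mathfrak g)=0$ and the space $H^2(\mathfrak g)$ is spanned by the classes of $\widehat x_1\wedge\widehat x_1$, $\widehat x_3\wedge\widehat x_3$, $\widehat y_1\wedge\widehat y_1$, $\widehat y_3\wedge\widehat y_3$.
   Context: $\mathfrak{sl}(1|2)$ consists of supertraceless $3\times3$ supermatrices (index $1$ even, indices $2,3$ odd); $x_1=E_{1,2}$ (odd), $x_2=E_{2,3}$ (even), $x_3=[x_1,x_2]$ (odd), $y_1=E_{2,1}$, $y_2=E_{3,2}$, $y_3=[y_1,y_2]$; for $p=2$ the squaring of odd elements is the matrix square. Hats denote elements of the dual basis with respect to the basis consisting of the $x_i$, $y_i$ and a basis of the diagonal subalgebra. $H^1(\mathfrak g;\mathfrak g)$ is the superspace of all (even and odd) derivations modulo inner ones; for $p=2$ derivations must also satisfy $D(x^2)=[Dx,x]$ for odd $x$. $H^2(\mathfrak g)$ (trivial coefficients, both parities) classifies one-dimensional central extensions. For $p\ne2$: 2-cocycles are bilinear forms with $\omega(x,y)=-(-1)^{p(x)p(y)}\omega(y,x)$, $\omega([x,y],z)=\omega(x,[y,z])-(-1)^{p(x)p(y)}\omega(y,[x,z])$ and, for $p=3$, $\omega(x,[x,x])=0$ for odd $x$; coboundaries are $f([x,y])$. For $p=2$: a 2-cocycle is a pair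 $(c,q)$, where $c$ is an alternating bilinear form on $\mathfrak g$ and $q$ is a quadratic form on $\mathfrak g_{\bar1}$ with polar form $c|_{\mathfrak g_{\bar1}}$, such that $c([x,y],z)+c([y,z],x)+c([z,x],y)=0$ and $c(x^2,y)=c(x,[x,y])$ for odd $x$ and all $y$; coboundaries are $c(x,y)=f([x,y])$, $q(x)=f(x^2)$; $\alpha\wedge\beta$ denotes the pair $c(x,y)=\alpha(x)\beta(y)+\alpha(y)\beta(x)$, $q(x)=\alpha(x)\beta(x)$, so that $\alpha\wedge\alpha$ is the pair $c=0$, $q=\alpha^2$. *)

(* Defs.v *)
From HB Require Import structures.
From mathcomp Require Import all_boot all_order all_algebra.
From mathcomp Require Import generic_quotient ring_quotient boolp functions.
From mathcomp Require Import ring.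

Set Implicit Arguments.
Unset Strict Implicit.
Unset Printing Implicit Defensive.

Import GRing.Theory.
Local Open Scope ring_scope.
Local Open Scope quotient_scope.

(** * Subquotients of a module *)

(* [subquot Z B] is [Z / (Z :&: B)], so that the ambient module may be larger
   than [Z] and no inclusion has to be carried around; in the uses below [B] is
   contained in [Z] (for [H2_char2], in characteristic 2). *)

Section Subquotient.
Variables (R : pzRingType) (V : lmodType R) (Z B : submodClosed V).

Record submod := Submod { submod_val : V; _ : submod_val \in Z }.

HB.instance Definition _ := [isSub for submod_val].
HB.instance Definition _ := [Choice of submod by <:].
HB.instance Definition _ := [SubChoice_isSubLmodule of submod by <:].

Definition bdry : {pred submod} := [pred z | val z \in B].

Lemma bdry_closed : zmod_closed bdry.
Proof.
split=> [|x y]; first exact: (rpred0 B).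
move=> xB yB; rewrite -[_ \in _]/(val (x - y) \in B) linearB.
by rewrite -scaleN1r rpredD // rpredZ.
Qed.

HB.instance Definition _ := GRing.isZmodClosed.Build submod bdry bdry_closed.

Definition subquot := Quotient.quot bdry.

HB.instance Definition _ := GRing.Zmodule.on subquot.

Definition subquot_class (z : submod) : subquot := \pi z.

Definition subquot_scale (a : R) (h : subquot) : subquot :=
  subquot_class (a *: repr h).

Lemma subquot_classE x y :
  (subquot_class x = subquot_class y) <-> (val x - val y \in B).
Proof.
rewrite -linearB -[_ \in B]/(x - y \in bdry) Quotient.idealrBE.
by split=> [/eqP|/eqP].
Qed.

Lemma subquot_classK (h : subquot) : subquot_class (repr h) = h.
Proof. exact: reprK. Qed.

Lemma subquot_scale_class a z :
  subquot_scale a (subquot_class z) = subquot_class (a *: z).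
Proof.
apply/subquot_classE; rewrite -linearB -scalerBr linearZ rpredZ // linearB.
by apply/subquot_classE; rewrite subquot_classK.
Qed.

Lemma subquot_classD x y :
  subquot_class (x + y) = subquot_class x + subquot_class y.
Proof. exact: Quotient.pi_add. Qed.

Fact subquot_scaleA a b h :
  subquot_scale a (subquot_scale b h) = subquot_scale (a * b) h.
Proof.
by rewrite -[h]subquot_classK !subquot_scale_class scalerA.
Qed.

Fact subquot_scale1 : left_id 1 subquot_scale.
Proof.
by move=> h; rewrite -[h]subquot_classK subquot_scale_class scale1r.
Qed.

Fact subquot_scaleDr : right_distributive subquot_scale +%R.
Proof.
move=> a h k; rewrite -[h]subquot_classK -[k]subquot_classK.
by rewrite -subquot_classD !subquot_scale_class -subquot_classD scalerDr.
Qed.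

Fact subquot_scaleDl h : {morph subquot_scale^~ h : a b / a + b}.
Proof.
move=> a b; rewrite -[h]subquot_classK !subquot_scale_class.
by rewrite -subquot_classD scalerDl.
Qed.

HB.instance Definition _ := GRing.Zmodule_isLmodule.Build R subquot
  subquot_scaleA subquot_scale1 subquot_scaleDr subquot_scaleDl.

End Subquotient.

(** * The Lie superalgebra sl(1|2) *)

Section Sl12.
Variable K : fieldType.

(* Matrix indices start at 0, so the even index is 0 and the odd ones 1, 2. *)
Definition oddix (i : 'I_3) : bool := i != 0.

(* [gl_part false A] and [gl_part true A] are the even (block-diagonal) and
   the odd (block-antidiagonal) parts of [A]. *)
Definition gl_part (b : bool) (A : 'M[K]_3) : 'M[K]_3 :=
  \matrix_(i, j) (if oddix i (+) oddix j == b then A i j else 0).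

Fact gl_part_linear b : linear (gl_part b).
Proof.
by move=> a A B; apply/matrixP => i j; rewrite !mxE; case: ifP => _ //; ring.
Qed.

HB.instance Definition _ b := GRing.isLinear.Build K 'M[K]_3 'M[K]_3 _
  (gl_part b) (gl_part_linear b).

Definition str (A : 'M[K]_3) : K^o := \sum_i (-1) ^+ oddix i * A i i.

Fact str_linear : linear str.
Proof.
move=> a A B; rewrite /str scaler_sumr -big_split /=; apply: eq_bigr => i _.
by rewrite !mxE -[_ *: _]/(a * _); ring.
Qed.

HB.instance Definition _ := GRing.isLinear.Build K 'M[K]_3 K^o _
  str str_linear.

(* The bilinear extension of [A B - (-1)^(p(A)p(B)) B A]. *)
Definition gl_br (A B : 'M[K]_3) : 'M[K]_3 :=
  A *m B - \sum_(a : bool) \sum_(b : bool)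
    (-1) ^+ (a && b) *: (gl_part b B *m gl_part a A).

Fact gl_br_linearl B : linear (gl_br^~ B).
Proof.
move=> a A A'; rewrite /gl_br !big_bool /= !linearP !mulmxDl -!scalemxAl.
by rewrite ?mulmxDr -?scalemxAr; apply/matrixP => i j; rewrite !mxE; ring.
Qed.

Fact gl_br_linearr A : linear (gl_br A).
Proof.
move=> a B B'; rewrite /gl_br !big_bool /= !linearP !mulmxDl -!scalemxAl.
by apply/matrixP => i j; rewrite !mxE; ring.
Qed.

Fact str_gl_br A B : str (gl_br A B) = 0.
Proof.
rewrite /str /gl_br !big_bool /= !(big_ord_recl, big_ord0) !mxE.
by rewrite !(big_ord_recl, big_ord0) !mxE /=; ring.
Qed.

Fact str_sqr_odd A : gl_part false A = 0 -> str (A *m A) = 0.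
Proof.
move=> A0; have {}A0 i j : ~~ (oddix i (+) oddix j) -> A i j = 0.
  by move=> /negbTE ij; have /matrixP/(_ i j) := A0; rewrite !mxE ij.
rewrite /str !(big_ord_recl, big_ord0) !mxE !(big_ord_recl, big_ord0) /=.
rewrite (A0 ord0 ord0) // (A0 (lift ord0 ord0) (lift ord0 _)) //.
rewrite (A0 (lift ord0 (lift ord0 _)) (lift ord0 ord0)) //.
rewrite (A0 (lift ord0 ord0) (lift ord0 (lift ord0 _))) //.
rewrite (A0 (lift ord0 (lift ord0 _)) (lift ord0 (lift ord0 _))) //.
by rewrite /=; ring.
Qed.

Definition sl12_space : {vspace 'M[K]_3} := lker (linfun str).

Lemma mem_sl12 A : (A \in sl12_space) = (str A == 0).
Proof. by rewrite memv_ker lfunE. Qed.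

Definition sl12 : vectType K := subvs_of sl12_space.

(* [sl12_gr false] and [sl12_gr true] are the even and odd parts. *)
Definition sl12_gr (b : bool) : {vspace sl12} :=
  lker (linfun (gl_part (~~ b) \o vsval : sl12 -> 'M[K]_3)).

Definition sl12_odd : vectType K := subvs_of (sl12_gr true).

Fact sl12_br_subproof (x y : sl12) : gl_br (vsval x) (vsval y) \in sl12_space.
Proof. by rewrite mem_sl12 str_gl_br. Qed.

Definition sl12_br (x y : sl12) : sl12 := Subvs (sl12_br_subproof x y).

Fact sl12_sq_subproof (x : sl12_odd) :
  vsval (vsval x) *m vsval (vsval x) \in sl12_space.
Proof.
rewrite mem_sl12; apply/eqP/str_sqr_odd.
by have := subvsP x; rewrite memv_ker lfunE => /eqP.
Qed.

Definition sl12_sq (x : sl12_odd) : sl12 := Subvs (sl12_sq_subproof x).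

Local Notation "{[ x , y ]}" := (sl12_br x y) (at level 0).

Lemma sl12_brDl a x x' y :
  {[a *: x + x', y]} = a *: {[x, y]} + {[x', y]}.
Proof. by apply: val_inj; rewrite /= gl_br_linearl. Qed.

Lemma sl12_brDr a x y y' :
  {[x, a *: y + y']} = a *: {[x, y]} + {[x, y']}.
Proof. by apply: val_inj; rewrite /= gl_br_linearr. Qed.

Lemma sl12_br0l y : {[0, y]} = 0.
Proof.
by have := sl12_brDl (-1) 0 0 y; rewrite !scaleN1r addNr addNr.
Qed.

Lemma sl12_br0r x : {[x, 0]} = 0.
Proof.
by have := sl12_brDr (-1) x 0 0; rewrite !scaleN1r addNr addNr.
Qed.

(** ** H^1(g; g) *)

(* A derivation of parity [b]. *)
Definition superder (b : bool) (D : 'End(sl12)) : Prop :=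
  [/\ forall (a : bool) (x : sl12), x \in sl12_gr a -> D x \in sl12_gr (a (+) b),
      forall (a : bool) (x y : sl12), x \in sl12_gr a ->
        D {[x, y]} = {[D x, y]} + (-1) ^+ (a && b) *: {[x, D y]}
    & 2%N \in [pchar K] ->
        forall x : sl12_odd, D (sl12_sq x) = {[D (vsval x), vsval x]}].

Definition der : {pred 'End(sl12)} := fun D =>
  `[< exists D0 D1, [/\ superder false D0, superder true D1 & D = D0 + D1] >].

Definition inner : {pred 'End(sl12)} := fun D =>
  `[< exists z, forall x, D x = {[z, x]} >].

Fact superder0 b : superder b 0.
Proof.
split=> [a x _|a x y _|_ x]; rewrite !lfunE /= ?mem0v //.
  by rewrite sl12_br0l sl12_br0r scaler0 addr0.
by rewrite sl12_br0l.
Qed.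

Fact superderP b k D E :
  superder b D -> superder b E -> superder b (k *: D + E).
Proof.
move=> [D1 D2 D3] [E1 E2 E3].
have lf x : (k *: D + E) x = k *: D x + E x by rewrite !lfunE /= !lfunE.
split=> [a x ax|a x y ax|K2 x]; rewrite !lf.
- by rewrite rpredD ?rpredZ ?D1 ?E1.
- rewrite (D2 a) // (E2 a) // sl12_brDl sl12_brDr !scalerDr !scalerA.
  by rewrite [_ * k]mulrC; exact: addrACA.
- by rewrite D3 // E3 // sl12_brDl.
Qed.

Fact der_closed : submod_closed der.
Proof.
split=> [|k D E /asboolP[D0 [D1 [hD0 hD1 ->]]] /asboolP[E0 [E1 [hE0 hE1 ->]]]].
  by apply/asboolP; exists 0, 0; split; rewrite ?addr0 //; exact: superder0.
apply/asboolP; exists (k *: D0 + E0), (k *: D1 + E1).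
by split; [exact: superderP|exact: superderP|rewrite scalerDr addrACA].
Qed.

Fact inner_closed : submod_closed inner.
Proof.
split=> [|k D E /asboolP[z zD] /asboolP[w wE]]; apply/asboolP.
  by exists 0 => x; rewrite lfunE /= sl12_br0l.
by exists (k *: z + w) => x; rewrite !lfunE /= !lfunE /= zD wE sl12_brDl.
Qed.

HB.instance Definition _ := GRing.isSubmodClosed.Build _ _ der der_closed.
HB.instance Definition _ := GRing.isSubmodClosed.Build _ _ inner inner_closed.

Definition H1 : lmodType K := subquot der inner.

(** ** H^2(g), characteristic different from 2 *)

(* [H2] is the second cohomology only in characteristic different from 2; in
   characteristic 2 use [H2_char2]. *)
Definition bilin (c : sl12 -> sl12 -> K^o) : Prop :=
  (forall x, linear (c x)) /\ (forall y, linear (c^~ y)).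

Definition cocycle : {pred sl12 -> sl12 -> K^o} := fun c =>
  `[< [/\ bilin c,
          forall (a b : bool) (x y : sl12), x \in sl12_gr a -> y \in sl12_gr b ->
            c x y = - ((-1) ^+ (a && b) * c y x),
          forall (a b : bool) (x y z : sl12),
            x \in sl12_gr a -> y \in sl12_gr b ->
            c {[x, y]} z = c x {[y, z]} - (-1) ^+ (a && b) * c y {[x, z]}
        & 3%N \in [pchar K] ->
            forall x : sl12, x \in sl12_gr true -> c x {[x, x]} = 0] >].

Definition cobdry : {pred sl12 -> sl12 -> K^o} := fun c =>
  `[< exists f : 'Hom(sl12, K^o), forall x y, c x y = f {[x, y]} >].

Fact bilin0 : bilin 0.
Proof. by split=> x a u v /=; rewrite scaler0 addr0. Qed.

Fact bilinP k c d : bilin c -> bilin d -> bilin (k *: c + d).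
Proof.
move=> [c1 c2] [d1 d2]; split=> x a u v.
  have -> t : (k *: c + d) x t = k *: c x t + d x t by [].
  rewrite c1 d1 !scalerDr !scalerA [a * k]mulrC addrACA //.
have -> t : (k *: c + d) t x = k *: c t x + d t x by [].
by rewrite c2 d2 !scalerDr !scalerA [a * k]mulrC addrACA.
Qed.

Fact cocycle_closed : submod_closed cocycle.
Proof.
split=> [|k c d /asboolP[c1 c2 c3 c4] /asboolP[d1 d2 d3 d4]]; apply/asboolP.
  split=> [|a b x y _ _|a b x y z _ _|_ x _] //=.
  - exact: bilin0.
  - by rewrite [0 x y]/0 [0 y x]/0 mulr0 oppr0.
  - by rewrite mulr0 subr0.
have E x y : (k *: c + d) x y = k * c x y + d x y by [].
split=> [|a b x y xa yb|a b x y z xa yb|K3 x x1]; rewrite ?E.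
- exact: bilinP.
- by rewrite (c2 a b) // (d2 a b) //; ring.
- by rewrite (c3 a b) // (d3 a b) //; ring.
- by rewrite c4 // d4 // mulr0 addr0.
Qed.

Fact cobdry_closed : submod_closed cobdry.
Proof.
split=> [|k c d /asboolP[f fc] /asboolP[g gd]]; apply/asboolP.
  by exists 0 => x y; rewrite lfunE.
exists (k *: f + g) => x y.
by rewrite !lfunE /= !lfunE /= -fc -gd.
Qed.

HB.instance Definition _ := GRing.isSubmodClosed.Build _ _ cocycle cocycle_closed.
HB.instance Definition _ := GRing.isSubmodClosed.Build _ _ cobdry cobdry_closed.

Definition H2 : lmodType K := subquot cocycle cobdry.

(** ** H^2(g), characteristic 2 *)

Definition cochain2 : lmodType K :=
  ((sl12 -> sl12 -> K^o) * (sl12_odd -> K^o))%type.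

(* In a cochain [(c, q)], [q] is a quadratic form on the odd part with polar
   form the restriction of [c]. *)
Definition is_cocycle2 (c : sl12 -> sl12 -> K^o) (q : sl12_odd -> K^o) : Prop :=
  [/\ bilin c /\ (forall x, c x x = 0),
      (forall k x, q (k *: x) = k ^+ 2 * q x) /\
      (forall x y, q (x + y) = q x + q y + c (vsval x) (vsval y)),
      forall x y z, c {[x, y]} z + c {[y, z]} x + c {[z, x]} y = 0
    & forall (x : sl12_odd) (y : sl12),
        c (sl12_sq x) y = c (vsval x) {[vsval x, y]}].

Definition is_cobdry2 (c : sl12 -> sl12 -> K^o) (q : sl12_odd -> K^o) : Prop :=
  exists f : 'Hom(sl12, K^o),
    (forall x y, c x y = f {[x, y]}) /\ (forall x, q x = f (sl12_sq x)).

Definition cocycle2 : {pred cochain2} := fun w => `[< is_cocycle2 w.1 w.2 >].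

Definition cobdry2 : {pred cochain2} := fun w => `[< is_cobdry2 w.1 w.2 >].

Fact is_cocycle2_0 : is_cocycle2 0 0.
Proof.
have E x y : (0 : sl12 -> sl12 -> K^o) x y = 0 by [].
have F x : (0 : sl12_odd -> K^o) x = 0 by [].
split=> [|||x y]; rewrite ?E //.
- by split=> [|x]; [exact: bilin0|rewrite E].
- by split=> [k x|x y]; rewrite !F ?E ?mulr0 ?addr0.
- by move=> x y z; rewrite !E !addr0.
Qed.

Fact is_cocycle2P k c d q r :
  is_cocycle2 c q -> is_cocycle2 d r -> is_cocycle2 (k *: c + d) (k *: q + r).
Proof.
move=> [[c1 c2] [c3 c4] c5 c6] [[d1 d2] [d3 d4] d5 d6].
have E x y : (k *: c + d) x y = k * c x y + d x y by [].
have F x : (k *: q + r) x = k * q x + r x by [].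
split=> [|||x y]; rewrite ?E.
- by split=> [|x]; [exact: bilinP|rewrite E c2 d2 mulr0 addr0].
- split=> [l x|x y]; first by rewrite !F c3 d3; ring.
  by rewrite !F E c4 d4; ring.
- move=> x y z; rewrite !E.
  transitivity (k * (c {[x, y]} z + c {[y, z]} x + c {[z, x]} y) +
                (d {[x, y]} z + d {[y, z]} x + d {[z, x]} y)); first by ring.
  by rewrite c5 d5 mulr0 addr0.
- by rewrite c6 d6.
Qed.

Fact cocycle2_closed : submod_closed cocycle2.
Proof.
split=> [|k w w' /asboolP cw /asboolP cw']; apply/asboolP.
  exact: is_cocycle2_0.
exact: is_cocycle2P.
Qed.

Fact is_cobdry2P k c d q r :
  is_cobdry2 c q -> is_cobdry2 d r -> is_cobdry2 (k *: c + d) (k *: q + r).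
Proof.
move=> [f [fc fq]] [g [gd gr]]; exists (k *: f + g).
have E x y : (k *: c + d) x y = k * c x y + d x y by [].
have F x : (k *: q + r) x = k * q x + r x by [].
by split=> [x y|x]; rewrite ?E ?F !lfunE /= !lfunE /= -?fc -?gd -?fq -?gr.
Qed.

Fact cobdry2_closed : submod_closed cobdry2.
Proof.
split=> [|k w w' /asboolP cw /asboolP cw']; apply/asboolP.
  by exists 0; split=> *; rewrite lfunE.
exact: is_cobdry2P.
Qed.

HB.instance Definition _ := GRing.isSubmodClosed.Build _ _ cocycle2 cocycle2_closed.
HB.instance Definition _ := GRing.isSubmodClosed.Build _ _ cobdry2 cobdry2_closed.

Definition H2_char2 : lmodType K := subquot cocycle2 cobdry2.

Definition wedge (u v : sl12 -> K) : cochain2 :=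
  (fun x y => u x * v y + u y * v x, fun x => u (vsval x) * v (vsval x)).

Fact wedge_sqr_cocycle (K2 : 2%N \in [pchar K]) (u : {scalar sl12}) :
  wedge u u \in cocycle2.
Proof.
apply/asboolP.
have E x y : (wedge u u).1 x y = 0 by rewrite /= [u y * _]mulrC addrr_pchar2.
have F x : (wedge u u).2 x = u (vsval x) ^+ 2 by rewrite /= expr2.
split=> [|||x y]; rewrite ?E //.
- by split=> //; split=> x a s t; rewrite !E scaler0 addr0.
- split=> [k x|x y]; first by rewrite !F !linearZ exprMn.
  by rewrite !F E addr0 !linearD sqrrD mulr2n addrr_pchar2 // addr0.
- by move=> x y z; rewrite !E !addr0.
Qed.

Definition wedge_sqr_class (K2 : 2%N \in [pchar K]) (u : {scalar sl12}) :
    H2_char2 :=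
  subquot_class cobdry2 (Submod (wedge_sqr_cocycle K2 u)).

(** ** Generators *)

Fact sl12_E_subproof (i j : 'I_3) : i != j ->
  delta_mx i j \in sl12_space.
Proof.
move=> ij; rewrite mem_sl12 /str big1 // => k _; rewrite !mxE.
by case: eqP => [->|]; rewrite ?(negbTE ij) ?mulr0.
Qed.

Definition sl12_E (i j : 'I_3) (ij : i != j) : sl12 :=
  Subvs (sl12_E_subproof ij).

Definition sl12_x1 : sl12 := @sl12_E 0 1 isT.
Definition sl12_x2 : sl12 := @sl12_E 1 2 isT.
Definition sl12_x3 : sl12 := {[sl12_x1, sl12_x2]}.
Definition sl12_y1 : sl12 := @sl12_E 1 0 isT.
Definition sl12_y2 : sl12 := @sl12_E 2 1 isT.
Definition sl12_y3 : sl12 := {[sl12_y1, sl12_y2]}.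

(* When [h1, h2] are diagonal and these eight elements form a basis, [h1, h2]
   is a basis of the diagonal subalgebra. *)
Definition sl12_seq (h1 h2 : sl12) : 8.-tuple sl12 :=
  [tuple sl12_x1; sl12_x2; sl12_x3; sl12_y1; sl12_y2; sl12_y3; h1; h2].

Definition hat_x1 (h1 h2 : sl12) : {scalar sl12} :=
  coord (sl12_seq h1 h2) (@Ordinal 8 0 isT).
Definition hat_x3 (h1 h2 : sl12) : {scalar sl12} :=
  coord (sl12_seq h1 h2) (@Ordinal 8 2 isT).
Definition hat_y1 (h1 h2 : sl12) : {scalar sl12} :=
  coord (sl12_seq h1 h2) (@Ordinal 8 3 isT).
Definition hat_y3 (h1 h2 : sl12) : {scalar sl12} :=
  coord (sl12_seq h1 h2) (@Ordinal 8 5 isT).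

End Sl12.

Fact pchar_eq2 (K : fieldType) (p : nat) :
  p = 2%N -> p \in [pchar K] -> 2%N \in [pchar K].
Proof. by move=> ->. Qed.

(* Main.v *)
From HB Require Import structures.
Require Import Defs.
From mathcomp Require Import all_boot all_order all_algebra.
From mathcomp Require Import generic_quotient ring_quotient boolp functions.
From mathcomp Require Import ring.

Set Implicit Arguments.
Unset Strict Implicit.
Unset Printing Implicit Defensive.

Import GRing.Theory.
Local Open Scope ring_scope.

(** Everything is decided by the torus of diagonal matrices, in every
    characteristic at once.  Two weights of the adjoint representation that are
    neither equal nor opposite differ by 1 or -1 on some vector of an integral
    basis of the torus; opposite roots may coincide (characteristic 2), but
    they are separated by the brackets [E_ij, E_jk] = E_ik.

    A homogeneous derivation, corrected by an inner one, preserves the torus,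
    hence kills it and maps E_ij to a combination of E_ij and E_ji.  The latter
    coefficient vanishes (both do for an odd derivation), the former is
    additive in (i, j), so the derivation is the bracket with a diagonal matrix.

    A 2-cocycle, corrected by a coboundary, vanishes on (torus, root vectors)
    and on (E_0m, E_m0), and then everywhere.  In characteristic 2 this
    leaves a pair (0, q) with q additive, hence a combination of the squares of
    the four odd coordinates. *)

Local Notation o0 := (@Ordinal 3 0 isT).
Local Notation o1 := (@Ordinal 3 1 isT).
Local Notation o2 := (@Ordinal 3 2 isT).

(** After this case split the indices are concrete ordinals, so that comparisons between them
    compute. *)
Lemma ord3_ind (P : 'I_3 -> Prop) : P o0 -> P o1 -> P o2 -> forall i, P i.
Proof.
move=> P0 P1 P2 [[|[|[|//]]] i3].
- by rewrite (_ : Ordinal i3 = o0) //; apply: val_inj.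
- by rewrite (_ : Ordinal i3 = o1) //; apply: val_inj.
- by rewrite (_ : Ordinal i3 = o2) //; apply: val_inj.
Qed.

Lemma sum_ord3 (V : nmodType) (F : 'I_3 -> V) :
  \sum_i F i = F o0 + F o1 + F o2.
Proof.
rewrite !big_ord_recl big_ord0 addr0 addrA.
by congr (F _ + F _ + F _); apply: val_inj.
Qed.

(** * Matrix units, grading and the super Lie identities *)

Section Sl12Cohomology.
Variable K : fieldType.
Local Notation sl := (sl12 K).
Implicit Types (A B : 'M[K]_3) (x y z h : sl) (i j k l m : 'I_3).

(** An entry at (i, k) lies in the part of parity [oddix i (+) oddix k], so the double sum over
    parts becomes a sign read off from positions. *)
Lemma gl_brE A B i j :
  gl_br A B i j = \sum_k (A i k * B k j -
    (-1) ^+ ((oddix i (+) oddix k) && (oddix k (+) oddix j)) * (B i k * A k j)).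
Proof.
rewrite /gl_br !big_bool !mxE !sum_ord3 !mxE.
by case: (oddix i); case: (oddix j); rewrite /=; ring.
Qed.

(** Supertracelessness makes the entry at (0, 0) redundant; vectors of [sl] are compared and built
    through the other eight entries. *)
Lemma sl12_strE x : vsval x o0 o0 = vsval x o1 o1 + vsval x o2 o2.
Proof.
have : vsval x \in sl12_space K := subvsP x.
rewrite mem_sl12 /str sum_ord3 /= => /eqP.
rewrite /oddix /= expr0 !expr1 => x0.
by rewrite -[RHS]addr0 -x0; ring.
Qed.

Lemma sl12_grP b x :
  reflect (forall i j, oddix i (+) oddix j != b -> vsval x i j = 0)
          (x \in sl12_gr K b).
Proof.
rewrite memv_ker lfunE; apply: (iffP eqP) => [/matrixP x0 i j ijb|x0].
  by have := x0 i j; rewrite !mxE; move: ijb; case: (_ (+) _); case: (b).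
apply/matrixP=> i j; rewrite !mxE; case: ifP => // ij; apply: x0.
by move: ij; case: (_ (+) _); case: (b).
Qed.

Fact sl12_unit_subproof i j :
  delta_mx i j - (str (delta_mx i j : 'M[K]_3) : K) *: delta_mx o0 o0
    \in sl12_space K.
Proof.
rewrite mem_sl12 linearB linearZ /=.
have -> : str (delta_mx o0 o0 : 'M[K]_3) = 1.
  by rewrite /str sum_ord3 !mxE /= /oddix /=; ring.
by apply/eqP; rewrite -[_ *: _]/(_ * _) mulr1 subrr.
Qed.

(* The projection of the matrix unit [E_ij] to sl(1|2) along [E_00]. *)
Definition sl12_unit : 'I_3 -> 'I_3 -> sl :=
  locked (fun i j => Subvs (sl12_unit_subproof i j)).
Local Notation u := sl12_unit.

Lemma sl12_unitE i j k l :
  vsval (u i j) k l = ((k == i) && (l == j))%:R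
    - (if i == j then (-1) ^+ oddix i else 0) * ((k == o0) && (l == o0))%:R.
Proof.
rewrite /sl12_unit -lock /= !mxE /str sum_ord3 !mxE; congr (_ - _ * _).
by elim/ord3_ind: i; elim/ord3_ind: j; rewrite /= /oddix /=; ring.
Qed.

Lemma sl12_unit00 : u o0 o0 = 0.
Proof.
apply/val_inj/matrixP => k l.
by rewrite sl12_unitE !mxE /= /oddix /=; ring.
Qed.

(* A locked copy of the bracket: failed unification of [sl12_br x y] with
   another vector would unfold both sides to matrices. *)
Definition br : sl -> sl -> sl := locked (@sl12_br K).
Local Notation "{[ x , y ]}" := (br x y) (at level 0).

Lemma brE x y : {[x, y]} = sl12_br x y.
Proof. by rewrite /br -lock. Qed.

Lemma brDl a x x' y : {[a *: x + x', y]} = a *: {[x, y]} + {[x', y]}.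
Proof. by rewrite !brE sl12_brDl. Qed.

Lemma brDr a x y y' : {[x, a *: y + y']} = a *: {[x, y]} + {[x, y']}.
Proof. by rewrite !brE sl12_brDr. Qed.

Lemma br0l y : {[0, y]} = 0.
Proof. by rewrite brE sl12_br0l. Qed.

Lemma br0r x : {[x, 0]} = 0.
Proof. by rewrite brE sl12_br0r. Qed.

Lemma brZl a x y : {[a *: x, y]} = a *: {[x, y]}.
Proof. by rewrite -[a *: x]addr0 brDl br0l addr0. Qed.

Lemma brZr a x y : {[x, a *: y]} = a *: {[x, y]}.
Proof. by rewrite -[a *: y]addr0 brDr br0r addr0. Qed.

Lemma brBl x x' y : {[x - x', y]} = {[x, y]} - {[x', y]}.
Proof. by rewrite addrC -scaleN1r brDl scaleN1r addrC. Qed.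

Lemma brBr x y y' : {[x, y - y']} = {[x, y]} - {[x, y']}.
Proof. by rewrite addrC -scaleN1r brDr scaleN1r addrC. Qed.

Lemma br_addr x y y' : {[x, y + y']} = {[x, y]} + {[x, y']}.
Proof. by rewrite -[y]scale1r brDr !scale1r. Qed.

Lemma br_addl x x' y : {[x + x', y]} = {[x, y]} + {[x', y]}.
Proof. by rewrite -[x]scale1r brDl !scale1r. Qed.

Lemma br_entry x y i j : vsval {[x, y]} i j =
  \sum_k (vsval x i k * vsval y k j -
    (-1) ^+ ((oddix i (+) oddix k) && (oddix k (+) oddix j)) *
      (vsval y i k * vsval x k j)).
Proof. by rewrite brE -gl_brE. Qed.

Lemma sl12_vsvalD x y i j : vsval (x + y) i j = vsval x i j + vsval y i j.
Proof. by rewrite linearD mxE. Qed.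

Lemma sl12_vsvalZ (a : K) x i j : vsval (a *: x) i j = a * vsval x i j.
Proof. by rewrite linearZ mxE. Qed.

Lemma sl12_vsvalN x i j : vsval (- x) i j = - vsval x i j.
Proof. by rewrite linearN mxE. Qed.

Lemma sl12_vsval0 i j : vsval (0 : sl) i j = 0.
Proof. by rewrite linear0 mxE. Qed.

Definition sl12_vsval_lin := (sl12_vsvalD, sl12_vsvalN, sl12_vsvalZ, sl12_vsval0).

(** The projection alters matrix units only at (0, 0), hence the restriction on k and l. *)
Lemma sl12_spanE (a : 'I_3 -> 'I_3 -> K) k l : (k != o0) || (l != o0) ->
  vsval (\sum_i \sum_j a i j *: u i j) k l = a k l.
Proof.
move=> kl; have -> : vsval (\sum_i \sum_j a i j *: u i j) k l =
    \sum_i \sum_j a i j * vsval (u i j) k l.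
  rewrite linear_sum summxE; apply: eq_bigr => i _.
  rewrite linear_sum summxE; apply: eq_bigr => j _.
  exact: sl12_vsvalZ.
rewrite (bigD1 k) //= (bigD1 l) //= sl12_unitE !eqxx /= -negb_and in kl *.
rewrite (negbTE kl) mulr0 subr0 mulr1 big1 => [|j /negbTE jl].
  rewrite addr0 big1 ?addr0 // => i /negbTE ik; apply: big1 => j _.
  by rewrite sl12_unitE (negbTE kl) eq_sym ik mulr0 subr0 mulr0.
by rewrite sl12_unitE (negbTE kl) eqxx eq_sym jl mulr0 subr0 mulr0.
Qed.

Lemma sl12_eqP x y :
  (forall k l, (k != o0) || (l != o0) -> vsval x k l = vsval y k l) -> x = y.
Proof.
move=> xy; apply/val_inj/matrixP => k l.
have [/andP[/eqP-> /eqP->]|] := boolP ((k == o0) && (l == o0)).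
  by rewrite !sl12_strE !xy.
by rewrite negb_and => /xy.
Qed.

Lemma sl12_sum_unit x : x = \sum_i \sum_j vsval x i j *: u i j.
Proof. by apply: sl12_eqP => k l kl; rewrite sl12_spanE. Qed.

Lemma sl12_gr_dec x : exists2 x0, x0 \in sl12_gr K false &
  exists2 x1, x1 \in sl12_gr K true & x = x0 + x1.
Proof.
pose part b : sl := \sum_i \sum_j
  (if oddix i (+) oddix j == b then vsval x i j else 0) *: u i j.
have partE b k l : vsval (part b) k l =
    if oddix k (+) oddix l == b then vsval x k l else 0.
  have [/andP[/eqP-> /eqP->]|] := boolP ((k == o0) && (l == o0)); last first.
    by rewrite negb_and => kl; rewrite sl12_spanE.
  by rewrite !sl12_strE !sl12_spanE //; case: b => //=; rewrite addr0.
exists (part false); last exists (part true).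
- by apply/sl12_grP => k l; rewrite partE => /negbTE->.
- by apply/sl12_grP => k l; rewrite partE => /negbTE->.
apply: sl12_eqP => k l _; rewrite sl12_vsvalD !partE.
by case: (_ (+) _); rewrite ?addr0 ?add0r.
Qed.

Lemma sl12_gr_unit i j : u i j \in sl12_gr K (oddix i (+) oddix j).
Proof.
apply/sl12_grP => k l; rewrite sl12_unitE /oddix.
by elim/ord3_ind: k; elim/ord3_ind: l; elim/ord3_ind: i;
  elim/ord3_ind: j => //= _; ring.
Qed.

(** In a nonzero term y_ik x_kj the position (i, k) has parity b and (k, j) has parity a, so the
    sign is the same for all k. *)
Lemma vsval_br_homog (a b : bool) x y : x \in sl12_gr K a -> y \in sl12_gr K b ->
  vsval {[x, y]} =
    vsval x *m vsval y - (-1) ^+ (a && b) *: (vsval y *m vsval x).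
Proof.
move=> /sl12_grP x_a /sl12_grP y_b; apply/matrixP => i j.
rewrite br_entry !mxE -mulrN -sumrN big_distrr -big_split /=.
apply: eq_bigr => k _; congr (_ + _); rewrite mulrN; congr (- _).
have [ij|/y_b->] := eqVneq (oddix i (+) oddix k) b; last by rewrite !(mul0r, mulr0).
have [jk|/x_a->] := eqVneq (oddix k (+) oddix j) a; last by rewrite !(mul0r, mulr0).
by rewrite ij jk andbC.
Qed.

Lemma sl12_gr_br (a b : bool) x y : x \in sl12_gr K a -> y \in sl12_gr K b ->
  {[x, y]} \in sl12_gr K (a (+) b).
Proof.
move=> x_a y_b; apply/sl12_grP => i j ij.
rewrite (vsval_br_homog x_a y_b) !mxE !big1 ?mulr0 ?subr0 //= => k _.
  have [jk|/(sl12_grP _ _ y_b)->] := eqVneq (oddix i (+) oddix k) b;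
    last by rewrite mul0r.
  have [ik|/(sl12_grP _ _ x_a)->] := eqVneq (oddix k (+) oddix j) a;
    last by rewrite mulr0.
  by move: ij; rewrite -jk -ik; case: (oddix i); case: (oddix j); case: (oddix k).
have [jk|/(sl12_grP _ _ x_a)->] := eqVneq (oddix i (+) oddix k) a;
  last by rewrite mul0r.
have [ik|/(sl12_grP _ _ y_b)->] := eqVneq (oddix k (+) oddix j) b;
  last by rewrite mulr0.
by move: ij; rewrite -jk -ik; case: (oddix i); case: (oddix j); case: (oddix k).
Qed.

Lemma sl12_skew (a b : bool) x y : x \in sl12_gr K a -> y \in sl12_gr K b ->
  {[x, y]} = - ((-1) ^+ (a && b) *: {[y, x]}).
Proof.
move=> x_a y_b; apply: sl12_eqP => i j _; rewrite !sl12_vsval_lin.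
rewrite (vsval_br_homog x_a y_b) (vsval_br_homog y_b x_a) andbC.
generalize (vsval x *m vsval y) (vsval y *m vsval x) => M N; rewrite !mxE.
by case: a b {x_a y_b} => [] [] /=; ring.
Qed.

(** Only the parities of x and y enter the sign, so z may be arbitrary: it is split into its even
    and odd parts. *)
Lemma sl12_jacobi (a b : bool) x y z : x \in sl12_gr K a -> y \in sl12_gr K b ->
  {[x, {[y, z]}]} = {[{[x, y]}, z]} + (-1) ^+ (a && b) *: {[y, {[x, z]}]}.
Proof.
move=> x_a y_b.
have homog c t : t \in sl12_gr K c ->
    {[x, {[y, t]}]} = {[{[x, y]}, t]} + (-1) ^+ (a && b) *: {[y, {[x, t]}]}.
  move=> t_c; apply: sl12_eqP => i j _; rewrite !sl12_vsval_lin.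
  rewrite (vsval_br_homog x_a (sl12_gr_br y_b t_c)) (vsval_br_homog y_b t_c).
  rewrite (vsval_br_homog y_b (sl12_gr_br x_a t_c)) (vsval_br_homog x_a t_c).
  rewrite (vsval_br_homog (sl12_gr_br x_a y_b) t_c) (vsval_br_homog x_a y_b).
  rewrite !(mulmxBl, mulmxBr) -!(scalemxAl, scalemxAr) !mulmxA.
  move: (vsval x) (vsval y) (vsval t) => X Y T.
  (* By associativity only the six words in X, Y, T remain; taken as unknown matrices they satisfy a
     linear identity for each choice of parities. *)
  move: (X *m Y *m T) (X *m T *m Y) (Y *m X *m T).
  move: (Y *m T *m X) (T *m X *m Y) (T *m Y *m X).
  move=> ? ? ? ? ? ?; rewrite !mxE.
  by case: a b c {x_a y_b t_c} => [] [] [] /=; ring.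
have [z0 z0_ev [z1 z1_odd ->]] := sl12_gr_dec z.
by rewrite !br_addr (homog _ _ z0_ev) (homog _ _ z1_odd) scalerDr addrACA.
Qed.

(** * Weights of the torus and brackets of matrix units *)

(** The root e_i - e_j evaluated at the torus vector [u m m], which is E_mm + E_00 for m nonzero and
    0 for m = 0. *)
Definition wt m i j : K := vsval (u m m) i i - vsval (u m m) j j.

Lemma br_diag h x : (forall i j, i != j -> vsval h i j = 0) ->
  forall i j, vsval {[h, x]} i j = (vsval h i i - vsval h j j) * vsval x i j.
Proof.
move=> hd i j; rewrite br_entry sum_ord3 /oddix.
have hd' := (hd o0 o1 isT, hd o0 o2 isT, hd o1 o0 isT,
            hd o1 o2 isT, hd o2 o0 isT, hd o2 o1 isT).
by elim/ord3_ind: i; elim/ord3_ind: j => /=; rewrite !hd'; ring.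
Qed.

Lemma unit_diag m i j : i != j -> vsval (u m m) i j = 0.
Proof.
rewrite sl12_unitE.
by elim/ord3_ind: i; elim/ord3_ind: j => //= _; elim/ord3_ind: m => /=; ring.
Qed.

Lemma br_unit_diag m x i j : vsval {[u m m, x]} i j = wt m i j * vsval x i j.
Proof. by rewrite br_diag // => *; apply: unit_diag. Qed.

(** The integral basis consists of [u o1 o1] and [u o2 o2]; both serve, since on one of them a
    difference of weights may be 0 or 2. The case k = l expresses that roots do not vanish on the
    torus. *)
Lemma weight_separation i j k l (v : K) :
  i != j -> (k, l) != (i, j) -> (k, l) != (j, i) ->
  (forall m, (wt m i j - wt m k l) * v = 0) -> v = 0.
Proof.
move=> + + + v0; have := v0 o2; have := v0 o1 => {v0}.
rewrite /wt !sl12_unitE /oddix.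
elim/ord3_ind: i; elim/ord3_ind: j => //=;
elim/ord3_ind: k; elim/ord3_ind: l => //= v1 v2 _ _ _.
(* The coefficient of [v] is 1 at m = 1, 1 at m = 2, -1 at m = 1 or -1 at m = 2, tried in this
   order. *)
all: try by rewrite -v1; ring.
all: try by rewrite -v2; ring.
all: try by rewrite -[RHS]oppr0 -v1; ring.
all: try by rewrite -[RHS]oppr0 -v2; ring.
Qed.

Lemma unit_offdiagE i j k l : i != j ->
  vsval (u i j) k l = ((k == i) && (l == j))%:R.
Proof. by move=> /negbTE ij; rewrite sl12_unitE ij mul0r subr0. Qed.

Lemma br_unit_weight m i j : i != j -> {[u m m, u i j]} = wt m i j *: u i j.
Proof.
move=> ij; apply: sl12_eqP => k l _.
rewrite br_unit_diag sl12_vsvalZ unit_offdiagE //.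
by case: (k =P i) => [->|]; case: (l =P j) => [->|] //= *; rewrite !mulr0.
Qed.

Lemma vsval_unit_offdiag i j : i != j -> vsval (u i j) = delta_mx i j.
Proof. by move=> ij; apply/matrixP => k l; rewrite unit_offdiagE // mxE. Qed.

Lemma br_unit i j k l : i != j -> k != l ->
  vsval {[u i j, u k l]} = delta_mx i l *+ (j == k)
    - (-1) ^+ ((oddix i (+) oddix j) && (oddix k (+) oddix l))
      *: (delta_mx k j *+ (l == i)).
Proof.
move=> ij kl; rewrite (vsval_br_homog (sl12_gr_unit i j) (sl12_gr_unit k l)).
by rewrite !vsval_unit_offdiag // !mul_delta_mx_cond.
Qed.

Lemma br_unit_comp i j k : i != j -> j != k -> i != k ->
  {[u i j, u j k]} = u i k.
Proof.
move=> ij jk ik; apply: val_inj; rewrite [LHS]br_unit // [RHS]vsval_unit_offdiag //.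
by rewrite eqxx [k == i]eq_sym (negbTE ik) mulr0n scaler0 subr0.
Qed.

Lemma br_unit_eq0 i j k l : i != j -> k != l -> j != k -> l != i ->
  {[u i j, u k l]} = 0.
Proof.
move=> ij kl /negbTE jk /negbTE li; apply: val_inj.
by rewrite [LHS]br_unit // jk li !mulr0n scaler0 subr0 [RHS]linear0.
Qed.

(** Both factors are odd, so this is the anticommutator E_00 + E_mm. *)
Lemma br_unit_opp m : m != o0 -> {[u o0 m, u m o0]} = u m m.
Proof.
move=> m0; have m0' : o0 != m by rewrite eq_sym.
apply: val_inj; rewrite [LHS]br_unit //; apply/matrixP => r s.
rewrite [RHS]sl12_unitE !eqxx !mulr1n /oddix m0 /= !mxE.
by ring.
Qed.

Lemma linear_unit_eq0 (V : lmodType K) (f : sl -> V) :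
  linear f -> (forall i j, f (u i j) = 0) -> forall x, f x = 0.
Proof.
move=> lf f0 x.
pose F : {linear sl -> V} := HB.pack f (GRing.isLinear.Build _ _ _ _ f lf).
rewrite -[f x]/(F x) (sl12_sum_unit x) linear_sum big1 // => i _.
by rewrite linear_sum big1 // => j _; rewrite linearZ /= f0 scaler0.
Qed.

Lemma br_unit_torus m n : {[u m m, u n n]} = 0.
Proof.
apply: sl12_eqP => k l _; rewrite br_unit_diag sl12_vsval0.
have [->|kl] := eqVneq k l; first by rewrite /wt subrr mul0r.
by rewrite unit_diag ?mulr0.
Qed.

(* The root [e_i - e_j] is 1 or -1 on [u m m] for [m := torus_index i j]. *)
Definition torus_index i j : 'I_3 := if (i == o2) || (j == o2) then o1 else o2.

(** A value of square 1 is its own inverse, so the normalizations divide by a weight through a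
    multiplication, in every characteristic. *)
Lemma torus_index_sqr i j : i != j ->
  wt (torus_index i j) i j * wt (torus_index i j) i j = 1.
Proof.
rewrite /wt /torus_index; elim/ord3_ind: i; elim/ord3_ind: j => //= _;
by rewrite !sl12_unitE /oddix /=; ring.
Qed.

(** Supplies the middle index that writes E_ij as [E_ik, E_kj]. *)
Lemma third_index i j : i != j -> exists k, (i != k) /\ (k != j).
Proof.
by elim/ord3_ind: i; elim/ord3_ind: j => // _;
  [exists o2|exists o1|exists o2|exists o0|exists o1|exists o0].
Qed.

(** * Homogeneous derivations are inner *)

Definition graded_der b (D : sl -> sl) : Prop :=
  [/\ linear D,
      forall (a : bool) x, x \in sl12_gr K a -> D x \in sl12_gr K (a (+) b)
    & forall (a : bool) x y, x \in sl12_gr K a ->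
        D {[x, y]} = {[D x, y]} + (-1) ^+ (a && b) *: {[x, D y]}].

Lemma graded_der_ad b D z : z \in sl12_gr K b -> graded_der b D ->
  graded_der b (fun x => D x - {[z, x]}).
Proof.
move=> z_b [D1 D2 D3]; split=> [k x y|a x x_a|a x y x_a].
- by rewrite D1 brDr scalerBr opprD addrACA.
- by rewrite rpredB ?D2 // addbC sl12_gr_br.
- rewrite (D3 a) // (sl12_jacobi _ z_b x_a) andbC.
  by rewrite brBl brBr scalerBr opprD addrACA.
Qed.

Lemma sl12_gr_unit_diag m : u m m \in sl12_gr K false.
Proof. by rewrite -(addbb (oddix m)) sl12_gr_unit. Qed.

Section GradedDerivation.
Variables (b : bool) (D : sl -> sl).
Hypothesis D_der : graded_der b D.

Let D_lin : linear D. Proof. by have [] := D_der. Qed.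

Lemma graded_derZ (a : K) x : D (a *: x) = a *: D x.
Proof.
have D0 : D 0 = 0 by have := D_lin (-1) 0 0; rewrite scaler0 add0r scaleN1r addNr.
by rewrite -[a *: x]addr0 D_lin D0 addr0.
Qed.

Lemma graded_der0 : D 0 = 0.
Proof. by have := graded_derZ 0 0; rewrite !scale0r. Qed.

Lemma graded_der_unit_diag m x :
  D {[u m m, x]} = {[D (u m m), x]} + {[u m m, D x]}.
Proof.
have [_ _ D3] := D_der.
by rewrite (D3 false) ?scale1r // sl12_gr_unit_diag.
Qed.

(** From [D] applied to [u m m, u n n] = 0: the component along E_ij of [D] on the torus is
    proportional to the root e_i - e_j. *)
Lemma graded_der_diag_comm m n i j :
  wt m i j * vsval (D (u n n)) i j = wt n i j * vsval (D (u m m)) i j.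
Proof.
have := graded_der_unit_diag m (u n n); rewrite br_unit_torus graded_der0.
have [_ D2 _] := D_der.
rewrite (sl12_skew (D2 _ _ (sl12_gr_unit_diag m)) (sl12_gr_unit_diag n)).
rewrite andbF scale1r.
move=> E; have {E} : vsval (0 : sl) i j =
    vsval (- {[u n n, D (u m m)]} + {[u m m, D (u n n)]}) i j.
  exact: (congr1 (fun x => vsval x i j) E).
rewrite [LHS]sl12_vsval0 [RHS]sl12_vsvalD [X in X + _]sl12_vsvalN.
rewrite (br_unit_diag n) (br_unit_diag m) => /eqP.
by rewrite eq_sym addrC subr_eq0 => /eqP.
Qed.

Lemma graded_der_diagonalize : exists2 z, z \in sl12_gr K b &
  forall m i j, i != j -> vsval (D (u m m) - {[z, u m m]}) i j = 0.
Proof.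
pose n i j := torus_index i j.
(* The (i, j) entry of [z, u m m] is - wt m i j z_ij. Matching it with that of [D (u m m)] for the
   single index m = [n i j] determines z_ij, and proportionality to the root gives all other m. *)
pose z : sl := \sum_i \sum_j
  (if i == j then 0
   else - (wt (n i j) i j * vsval (D (u (n i j) (n i j))) i j)) *: u i j.
have zE i j : i != j -> vsval z i j =
    - (wt (n i j) i j * vsval (D (u (n i j) (n i j))) i j).
  move=> ij; rewrite /z sl12_spanE ?(negbTE ij) //.
  by rewrite -negb_and; apply: contraNN ij => /andP[/eqP-> /eqP->].
have zd i : vsval z i i = 0.
  by elim/ord3_ind: i; rewrite ?sl12_strE /z !sl12_spanE //= ?addr0.
have z_b : z \in sl12_gr K b.
  apply/sl12_grP => i j ijb; have [<-|ij] := eqVneq i j; first exact: zd.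
  have [_ D2 _] := D_der.
  by rewrite zE // (sl12_grP _ _ (D2 _ _ (sl12_gr_unit_diag _))) ?mulr0 ?oppr0.
exists z => // m i j ij.
rewrite (sl12_skew z_b (sl12_gr_unit_diag m)) andbF scale1r opprK.
rewrite sl12_vsvalD br_unit_diag zE // mulrN mulrCA graded_der_diag_comm.
rewrite mulrA torus_index_sqr //.
by rewrite mul1r subrr.
Qed.

Hypothesis D_diag : forall m i j, i != j -> vsval (D (u m m)) i j = 0.

(** The entry at (k, l) of [D] applied to [u m m, u i j] = wt m i j u i j. At (i, j) it constrains
    [D] on the torus; elsewhere it compares weights. *)
Lemma graded_der_unitE m i j k l : i != j ->
  wt m i j * vsval (D (u i j)) k l =
    (vsval (D (u m m)) k k - vsval (D (u m m)) l l) * ((k == i) && (l == j))%:R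
    + wt m k l * vsval (D (u i j)) k l.
Proof.
move=> ij; have := graded_der_unit_diag m (u i j).
rewrite br_unit_weight // graded_derZ => /(congr1 (fun x => vsval x k l)).
rewrite sl12_vsvalZ => ->; rewrite sl12_vsvalD.
by rewrite (br_diag _ (D_diag m)) br_unit_diag unit_offdiagE.
Qed.

(** The diagonal entries of [D (u m m)] all agree, and a scalar matrix d has supertrace -d, so d = 0
    in every characteristic. *)
Lemma graded_der_diag0 m : D (u m m) = 0.
Proof.
have d_eq i j : i != j -> vsval (D (u m m)) i i = vsval (D (u m m)) j j.
  move=> ij; have := graded_der_unitE m i j ij; rewrite !eqxx mulr1 -[LHS]add0r.
  by move=> /addIr/esym/eqP; rewrite subr_eq0 => /eqP.
have d0 : vsval (D (u m m)) o0 o0 = 0.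
  have := sl12_strE (D (u m m)).
  by rewrite -(d_eq o0 o1) // -(d_eq o0 o2) // -{1}[X in X = _]addr0 => /addrI.
apply: sl12_eqP => i j _; rewrite sl12_vsval0.
have [<-|/D_diag//] := eqVneq i j.
by have [->|/d_eq->] := eqVneq i o0.
Qed.

Lemma graded_der_off0 i j k l : i != j -> (k, l) != (i, j) -> (k, l) != (j, i) ->
  vsval (D (u i j)) k l = 0.
Proof.
move=> ij klij klji; apply: (weight_separation ij klij klji) => m.
rewrite mulrBl graded_der_unitE // graded_der_diag0 !sl12_vsval0.
by rewrite subrr mul0r add0r subrr.
Qed.

(** E_ij and E_ji have the same parity, so an odd [D] has no component on either, and weights
    exclude all other entries. *)
Lemma graded_der_odd0 : b -> forall x, D x = 0.
Proof.
move=> b1; apply: (linear_unit_eq0 D_lin) => i j.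
have [->|ij] := eqVneq i j; first exact: graded_der_diag0.
have [_ /(_ _ _ (sl12_gr_unit i j)) /sl12_grP D2 _] := D_der.
apply: sl12_eqP => k l _; rewrite sl12_vsval0.
have [[-> ->]|ne1] := eqVneq (k, l) (i, j).
  by apply: D2; rewrite b1; case: (_ (+) _).
have [[-> ->]|ne2] := eqVneq (k, l) (j, i); last exact: graded_der_off0.
by apply: D2; rewrite b1 addbC; case: (_ (+) _).
Qed.

Hypothesis b0 : b = false.

Lemma graded_der_even x y a : x \in sl12_gr K a ->
  D {[x, y]} = {[D x, y]} + {[x, D y]}.
Proof.
by have [_ _ D3] := D_der => x_a; rewrite (D3 a) // b0 andbF scale1r.
Qed.

Let lam i j := vsval (D (u i j)) i j.
Let mu i j := vsval (D (u i j)) j i.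

Lemma graded_der_lam_mu i j : i != j ->
  D (u i j) = lam i j *: u i j + mu i j *: u j i.
Proof.
move=> ij; have ji : j != i by rewrite eq_sym.
apply: sl12_eqP => k l _; rewrite !sl12_vsval_lin !unit_offdiagE //.
have [[-> ->]|ne1] := eqVneq (k, l) (i, j).
  by rewrite !eqxx (negbTE ij) mulr1 mulr0 addr0.
have [[-> ->]|ne2] := eqVneq (k, l) (j, i).
  by rewrite !eqxx (negbTE ij) (negbTE ji) mulr1 mulr0 add0r.
rewrite graded_der_off0 //; rewrite !xpair_eqE in ne1 ne2.
by rewrite (negbTE ne1) (negbTE ne2) !mulr0 addr0.
Qed.

(** In the Leibniz rule for [E_ij, E_jk] the opposite components contribute only [E_ji, E_jk] and
    [E_ij, E_kj], which vanish. This removes the E_ki component and adds the eigenvalues. *)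
Lemma graded_der_comp i j k : i != j -> j != k -> i != k ->
  D (u i k) = (lam i j + lam j k) *: u i k.
Proof.
move=> ij jk ik.
have [ji kj ki] : [/\ j != i, k != j & k != i] by split; rewrite eq_sym.
rewrite -(br_unit_comp ij jk ik) (graded_der_even _ (sl12_gr_unit i j)).
rewrite !graded_der_lam_mu // brDl br_addr.
rewrite !brZl !brZr br_unit_comp // (br_unit_eq0 ji jk) // (br_unit_eq0 ij kj) //.
by rewrite !scaler0 !addr0 scalerDl.
Qed.

Lemma graded_der_lam_comp i j k : i != j -> j != k -> i != k ->
  lam i k = lam i j + lam j k.
Proof.
move=> ij jk ik; rewrite {1}/lam (graded_der_comp ij jk ik) sl12_vsvalZ.
by rewrite unit_offdiagE // !eqxx mulr1.
Qed.

Lemma graded_der_weight i j : i != j -> D (u i j) = lam i j *: u i j.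
Proof.
move=> ij; have [k [ik kj]] := third_index ij.
by rewrite (graded_der_comp ik kj ij) -(graded_der_lam_comp ik kj ij).
Qed.

Lemma graded_der_lam_opp m : m != o0 -> lam o0 m + lam m o0 = 0.
Proof.
move=> m0; have m0' : o0 != m by rewrite eq_sym.
have := graded_der_diag0 m; rewrite -br_unit_opp //.
rewrite (graded_der_even _ (sl12_gr_unit o0 m)) !graded_der_weight //.
rewrite brZl brZr -scalerDl.
move/(congr1 (fun x => vsval x m m)).
rewrite sl12_vsvalZ sl12_vsval0 br_unit_opp //.
by rewrite sl12_unitE eqxx (negbTE m0) mulr0 subr0 mulr1.
Qed.

Lemma graded_der_torus : exists z, forall x, D x = {[z, x]}.
Proof.
(* The additive [lam] is a difference of potentials, lam i j = g i - g j, normalized by g(0) = 0.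
   Adding the constant [t] to the diagonal keeps these differences and makes the supertrace zero. *)
pose g i := if i == o0 then 0 else lam i o0.
pose t := g o0 - g o1 - g o2.
pose z : sl := \sum_i \sum_j (if i == j then g i + t else 0) *: u i j.
have zE i : vsval z i i = g i + t.
  by elim/ord3_ind: i; rewrite ?sl12_strE /z !sl12_spanE //= /t; ring.
have zd i j : i != j -> vsval z i j = 0.
  move=> ij; rewrite /z sl12_spanE ?(negbTE ij) //.
  by rewrite -negb_and; apply: contraNN ij => /andP[/eqP-> /eqP->].
have lamE i j : i != j -> lam i j = g i - g j.
  move=> ij; rewrite /g; have [i0|i0] := eqVneq i o0; have [j0|j0] := eqVneq j o0.
  - by rewrite i0 j0 eqxx in ij.
  - by rewrite i0; apply/eqP; rewrite sub0r -addr_eq0 graded_der_lam_opp.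
  - by rewrite j0 subr0.
  - have j0' : o0 != j by rewrite eq_sym.
    rewrite (graded_der_lam_comp i0 j0' ij); congr (_ + _); apply/eqP.
    by rewrite -addr_eq0 graded_der_lam_opp.
exists z => x; apply/eqP; rewrite -subr_eq0; apply/eqP.
apply: (linear_unit_eq0 (f := fun x => D x - {[z, x]})) => [k v w|i j].
  by rewrite D_lin brDr scalerBr opprD addrACA.
apply: sl12_eqP => k l _; rewrite !sl12_vsval_lin br_diag // !zE.
have [<-|ij] := eqVneq i j.
  rewrite graded_der_diag0 sl12_vsval0 add0r.
  have [->|kl] := eqVneq k l; first by rewrite subrr mul0r oppr0.
  by rewrite unit_diag // mulr0 oppr0.
rewrite graded_der_weight // sl12_vsvalZ lamE // unit_offdiagE //.
by case: (k =P i) => [->|]; case: (l =P j) => [->|] //= *; ring.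
Qed.

End GradedDerivation.

Lemma graded_der_inner b D : graded_der b D -> exists z, forall x, D x = {[z, x]}.
Proof.
move=> D_der; have [z z_b zD] := graded_der_diagonalize D_der.
have D'_der := graded_der_ad z_b D_der.
have [z' z'E] : exists z', forall x, D x - {[z, x]} = {[z', x]}.
  case: b z_b D_der zD D'_der => z_b D_der zD D'_der; last first.
    exact: (graded_der_torus D'_der zD).
  by exists 0 => x; rewrite br0l (graded_der_odd0 D'_der zD).
by exists (z + z') => x; rewrite br_addl -z'E addrC subrK.
Qed.

Lemma subquot_class_eq0 (R : pzRingType) (V : lmodType R) (Z B : submodClosed V)
  (z : submod Z) : val z \in B -> subquot_class B z = 0.
Proof.
move=> zB; apply: (addrI (subquot_class B z)); rewrite -subquot_classD addr0.
by apply/subquot_classE; rewrite linearD /= addrK.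
Qed.

Lemma superder_graded b D : superder b D -> graded_der b D.
Proof.
case=> D1 D2 _; split=> [||a x y x_a]; [exact: linearP|exact: D1|].
by rewrite !brE (D2 a).
Qed.

Lemma H1_eq0 (h : H1 K) : h = 0.
Proof.
rewrite -[h]subquot_classK; apply: subquot_class_eq0; apply/asboolP.
case: (repr h) => D /= /asboolP[D0 [D1 [D0_der D1_der ->]]].
have [z0 z0E] := graded_der_inner (superder_graded D0_der).
have [z1 z1E] := graded_der_inner (superder_graded D1_der).
exists (z0 + z1) => x; rewrite lfunE /= z0E z1E -brE.
by rewrite br_addl.
Qed.

(** * Super 2-cocycles are coboundaries *)

Lemma formD (f : 'Hom(sl, K^o)) x y : f (x + y) = f x + f y.
Proof. exact: linearD. Qed.

Lemma formN (f : 'Hom(sl, K^o)) x : f (- x) = - f x.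
Proof. exact: linearN. Qed.

Lemma formZ (f : 'Hom(sl, K^o)) (a : K) x : f (a *: x) = a * f x.
Proof. exact: linearZ. Qed.

(** The identities shared by [cocycle] and, through [cocycle2_super], by the bilinear component of a
    cocycle in characteristic 2. *)
Definition super_cocycle (c : sl -> sl -> K^o) : Prop :=
  [/\ bilin c,
      forall (a b : bool) x y, x \in sl12_gr K a -> y \in sl12_gr K b ->
        c x y = - ((-1) ^+ (a && b) * c y x)
    & forall (a b : bool) x y z, x \in sl12_gr K a -> y \in sl12_gr K b ->
        c {[x, y]} z = c x {[y, z]} - (-1) ^+ (a && b) * c y {[x, z]}].

Lemma super_cocycle_sub_cobdry c (f : 'Hom(sl, K^o)) : super_cocycle c ->
  super_cocycle (fun x y => c x y - f {[x, y]}).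
Proof.
case=> [[c1 c2] c3 c4]; split.
- split=> x a y z; first by rewrite c1 brDr linearP scalerBr opprD addrACA.
  by rewrite c2 brDl linearP scalerBr opprD addrACA.
- move=> a b x y x_a y_b; rewrite (c3 _ _ _ _ x_a y_b) (sl12_skew x_a y_b).
  by rewrite formN formZ; ring.
- move=> a b x y z x_a y_b; rewrite (c4 _ _ _ _ _ x_a y_b) (sl12_jacobi z x_a y_b).
  by rewrite formD formZ; ring.
Qed.

Section NormalizedCocycle.
Variable c : sl -> sl -> K^o.
Hypothesis c_cocycle : super_cocycle c.

Let c_linr x : linear (c x). Proof. by have [[]] := c_cocycle. Qed.
Let c_linl y : linear (c^~ y). Proof. by have [[]] := c_cocycle. Qed.

Lemma cocycle0r x : c x 0 = 0.
Proof. by have := c_linr x (-1) 0 0; rewrite scaler0 addr0 scaleN1r addNr. Qed.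

Lemma cocycle0l y : c 0 y = 0.
Proof. by have := c_linl y (-1) 0 0; rewrite scaler0 addr0 scaleN1r addNr. Qed.

Lemma cocycleZr (a : K) x y : c x (a *: y) = a * c x y.
Proof. by rewrite -[a *: y]addr0 c_linr cocycle0r addr0. Qed.

Lemma cocycleZl (a : K) x y : c (a *: x) y = a * c x y.
Proof. by rewrite -[a *: x]addr0 c_linl cocycle0l addr0. Qed.

Lemma cocycle_skew i j x (a : bool) : x \in sl12_gr K a ->
  c x (u i j) = - ((-1) ^+ (a && (oddix i (+) oddix j)) * c (u i j) x).
Proof.
by have [_ c3 _] := c_cocycle => x_a; apply: c3 => //; apply: sl12_gr_unit.
Qed.

Lemma cocycle_skew0 i j k l : c (u i j) (u k l) = 0 -> c (u k l) (u i j) = 0.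
Proof.
by move=> c0; rewrite (cocycle_skew _ _ (sl12_gr_unit k l)) c0 mulr0 oppr0.
Qed.

Lemma cocycle_jacobi i j k l x : c {[u i j, u k l]} x = c (u i j) {[u k l, x]} -
  (-1) ^+ ((oddix i (+) oddix j) && (oddix k (+) oddix l)) * c (u k l) {[u i j, x]}.
Proof. by have [_ _ c4] := c_cocycle; apply: c4; apply: sl12_gr_unit. Qed.

Lemma cocycle_diag_jacobi m k l x :
  c {[u m m, u k l]} x = c (u m m) {[u k l, x]} - c (u k l) {[u m m, x]}.
Proof. by rewrite cocycle_jacobi addbb /= expr0 mul1r. Qed.

(** The counterpart of [graded_der_diag_comm], from the cocycle identity on [u m m, u n n] = 0. *)
Lemma cocycle_diag_comm m n i j : i != j ->
  wt m i j * c (u n n) (u i j) = wt n i j * c (u m m) (u i j).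
Proof.
move=> ij; have := cocycle_diag_jacobi m n n (u i j).
rewrite br_unit_torus cocycle0l !br_unit_weight // !cocycleZr => /eqP.
by rewrite eq_sym subr_eq0 => /eqP.
Qed.

Hypothesis c_torus : forall m i j, i != j -> c (u m m) (u i j) = 0.
Hypothesis c_opp : forall m, m != o0 -> c (u o0 m) (u m o0) = 0.

Lemma br_unit_weightr m i j : i != j -> {[u i j, u m m]} = - wt m i j *: u i j.
Proof.
move=> ij; rewrite (sl12_skew (sl12_gr_unit i j) (sl12_gr_unit_diag m)).
by rewrite andbF scale1r br_unit_weight // scaleNr.
Qed.

(** Against another torus vector, write [u m m] as [E_0m, E_m0]: the cocycle identity leaves
    multiples of the normalized values on E_0m and E_m0. *)
Lemma cocycle_diag0 m x : c (u m m) x = 0.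
Proof.
apply: (linear_unit_eq0 (c_linr _)) => i j.
have [<-|] := eqVneq i j; last exact: c_torus.
have [->|m0] := eqVneq m o0; first by rewrite sl12_unit00 cocycle0l.
have m0' : o0 != m by rewrite eq_sym.
rewrite -(br_unit_opp m0) cocycle_jacobi !br_unit_weightr //.
rewrite !cocycleZr (c_opp m0) (cocycle_skew0 (c_opp m0)).
by rewrite !mulr0 subr0.
Qed.

(** Invariance of [c] under the torus: the sum of the weights of E_ij and E_kl kills their pairing.
    Written as a difference with the root at (l, k), it fits [weight_separation], whose exceptions
    become opposite and equal roots. *)
Lemma cocycle_weight m i j k l : i != j -> k != l ->
  (wt m i j - wt m l k) * c (u i j) (u k l) = 0.
Proof.
move=> ij kl; have := cocycle_diag_jacobi m i j (u k l).
rewrite !br_unit_weight // cocycleZl cocycleZr cocycle_diag0 sub0r => E.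
by rewrite mulrBl E /wt; ring.
Qed.

(** E_ij is the bracket of E_ik and E_kj, both of which have zero bracket with E_ij. *)
Lemma cocycle_same0 i j : i != j -> c (u i j) (u i j) = 0.
Proof.
move=> ij; have [k [ik kj]] := third_index ij.
have ji : j != i by rewrite eq_sym.
have ki : k != i by rewrite eq_sym.
have jk : j != k by rewrite eq_sym.
rewrite -{1}(br_unit_comp ik kj ij) cocycle_jacobi.
by rewrite (br_unit_eq0 kj) // (br_unit_eq0 ik) // !cocycle0r mulr0 subr0.
Qed.

Lemma cocycle_opp0 i j : i != j -> c (u i j) (u j i) = 0.
Proof.
(* The one opposite pair avoiding the index 0: since E_12 = [E_10, E_02], the cocycle identity
   reduces it to pairs through 0. *)
have c12 : c (u o1 o2) (u o2 o1) = 0.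
  rewrite -(@br_unit_comp o1 o0 o2) // cocycle_jacobi.
  rewrite (@br_unit_comp o0 o2 o1) // (cocycle_skew0 (c_opp _)) //.
  have -> : {[u o1 o0, u o2 o1]} = - (u o2 o0).
    rewrite (sl12_skew (sl12_gr_unit _ _) (sl12_gr_unit _ _)) /oddix /=.
    by rewrite scale1r br_unit_comp.
  by rewrite -[- u _ _]scaleN1r cocycleZr c_opp // !mulr0 subr0.
by elim/ord3_ind: i; elim/ord3_ind: j => // _;
  first [exact: c_opp | exact: c12
     | apply: cocycle_skew0; exact: c_opp | apply: cocycle_skew0; exact: c12].
Qed.

Lemma normalized_cocycle0 x y : c x y = 0.
Proof.
move: x; apply: (linear_unit_eq0 (c_linl y)) => i j.
move: y; apply: (linear_unit_eq0 (c_linr _)) => k l.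
have [<-|ij] := eqVneq i j; first exact: cocycle_diag0.
have [<-|kl] := eqVneq k l; first by apply: cocycle_skew0; exact: cocycle_diag0.
have [[-> ->]|ne1] := eqVneq (l, k) (i, j); first exact: cocycle_opp0.
have [[-> ->]|ne2] := eqVneq (l, k) (j, i); first exact: cocycle_same0.
by apply: (weight_separation ij ne1 ne2) => m; apply: cocycle_weight.
Qed.

End NormalizedCocycle.

(** The vector [u o0 o0] is 0 and the other eight units form a basis, so the remaining values can be
    prescribed freely. *)
Lemma linear_form_unit (g : 'I_3 -> 'I_3 -> K) : g o0 o0 = 0 ->
  exists f : 'Hom(sl, K^o), forall i j, f (u i j) = g i j.
Proof.
move=> g00; pose F x : K^o := \sum_i \sum_j vsval x i j * g i j.
have F_lin : linear F.
  move=> a x y; rewrite -[_ *: F _]/(a * _) /F !sum_ord3.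
  by rewrite !sl12_vsvalD !sl12_vsvalZ; ring.
pose F' : {linear sl -> K^o} := HB.pack F (GRing.isLinear.Build _ _ _ _ F F_lin).
exists (linfun F') => i j; rewrite lfunE /= /F !sum_ord3 !sl12_unitE /oddix.
by elim/ord3_ind: i; elim/ord3_ind: j; rewrite /= g00; ring.
Qed.

Lemma super_cocycle_cobdry c : super_cocycle c ->
  exists f : 'Hom(sl, K^o), forall x y, c x y = f {[x, y]}.
Proof.
move=> cc; pose n i j := torus_index i j.
(* The values are dictated by the normalization: [E_0i, E_i0] is [u i i], and [u n n, E_ij] is E_ij
   up to sign for n = [n i j]. *)
pose g i j : K := if i == j then c (u o0 i) (u i o0)
  else wt (n i j) i j * c (u (n i j) (n i j)) (u i j).
have [|f fE] := @linear_form_unit g; first by rewrite /g /= sl12_unit00 cocycle0l.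
exists f => x y; apply/eqP; rewrite -subr_eq0; apply/eqP.
apply: (normalized_cocycle0 (super_cocycle_sub_cobdry f cc)) => [m i j ij|m m0].
  rewrite br_unit_weight // formZ fE /g (negbTE ij).
  rewrite mulrCA cocycle_diag_comm // mulrA torus_index_sqr //.
  by rewrite mul1r subrr.
by rewrite br_unit_opp // fE /g eqxx subrr.
Qed.

Lemma subquot_classZ (R : pzRingType) (V : lmodType R) (Z B : submodClosed V) a
  (z : submod Z) : a *: subquot_class B z = subquot_class B (a *: z).
Proof. exact: subquot_scale_class. Qed.

Lemma H2_eq0 (h : H2 K) : h = 0.
Proof.
rewrite -[h]subquot_classK; apply: subquot_class_eq0; apply/asboolP.
case: (repr h) => c /= /asboolP[c1 c2 c3 _].
have [|f fE] := @super_cocycle_cobdry c.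
  by split=> // a b x y z x_a y_b; rewrite !brE; apply: c3.
by exists f => x y; rewrite fE brE.
Qed.

(** * The generators and their dual coordinates as matrix entries *)

Lemma sl12_E_unit i j (ij : i != j) : sl12_E K ij = u i j.
Proof. by apply: val_inj; rewrite [RHS]vsval_unit_offdiag. Qed.

Lemma sl12_x1E : sl12_x1 K = u o0 o1.
Proof. by rewrite /sl12_x1 sl12_E_unit; congr sl12_unit; apply: val_inj. Qed.

Lemma sl12_x2E : sl12_x2 K = u o1 o2.
Proof. by rewrite /sl12_x2 sl12_E_unit; congr sl12_unit; apply: val_inj. Qed.

Lemma sl12_x3E : sl12_x3 K = u o0 o2.
Proof. by rewrite /sl12_x3 sl12_x1E sl12_x2E -brE br_unit_comp. Qed.

Lemma sl12_y1E : sl12_y1 K = u o1 o0.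
Proof. by rewrite /sl12_y1 sl12_E_unit; congr sl12_unit; apply: val_inj. Qed.

Lemma sl12_y2E : sl12_y2 K = u o2 o1.
Proof. by rewrite /sl12_y2 sl12_E_unit; congr sl12_unit; apply: val_inj. Qed.

(** E_10 E_21 = 0, so only the subtracted product of the commutator survives. The sign will
    disappear in the square of [hat_y3]. *)
Lemma sl12_y3E : sl12_y3 K = - u o2 o0.
Proof.
rewrite /sl12_y3 sl12_y1E sl12_y2E -brE.
rewrite (sl12_skew (sl12_gr_unit _ _) (sl12_gr_unit _ _)) /oddix /=.
by rewrite scale1r br_unit_comp.
Qed.

Section Hats.
Variables h1 h2 : sl.
Hypothesis h1_diag : is_diag_mx (vsval h1).
Hypothesis h2_diag : is_diag_mx (vsval h2).
Hypothesis basis_seq : basis_of fullv (sl12_seq h1 h2).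

(** The list holds the (i, j) entries of the six root vectors; the default 0 of [nth] stands for
    [h1] and [h2], which vanish off the diagonal. *)
Lemma hat_entry x i j : i != j -> vsval x i j =
  \sum_(k < 8) coord (sl12_seq h1 h2) k x *
    nth 0 [:: ((i == o0) && (j == o1))%:R; ((i == o1) && (j == o2))%:R;
      ((i == o0) && (j == o2))%:R; ((i == o1) && (j == o0))%:R;
      ((i == o2) && (j == o1))%:R; - ((i == o2) && (j == o0))%:R] k.
Proof.
move=> ij; rewrite {1}(coord_basis basis_seq (memvf x)) linear_sum summxE.
apply: eq_bigr => k _; rewrite [LHS]sl12_vsvalZ; congr (_ * _).
case: k => [[|[|[|[|[|[|[|[|//]]]]]]]] ?].
- by rewrite -[LHS]/(vsval (sl12_x1 K) i j) sl12_x1E unit_offdiagE.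
- by rewrite -[LHS]/(vsval (sl12_x2 K) i j) sl12_x2E unit_offdiagE.
- by rewrite -[LHS]/(vsval (sl12_x3 K) i j) sl12_x3E unit_offdiagE.
- by rewrite -[LHS]/(vsval (sl12_y1 K) i j) sl12_y1E unit_offdiagE.
- by rewrite -[LHS]/(vsval (sl12_y2 K) i j) sl12_y2E unit_offdiagE.
- by rewrite -[LHS]/(vsval (sl12_y3 K) i j) sl12_y3E sl12_vsvalN unit_offdiagE.
- by move/is_diag_mxP: h1_diag; apply.
- by move/is_diag_mxP: h2_diag; apply.
Qed.

Lemma hat_x1E x : hat_x1 h1 h2 x = vsval x o0 o1.
Proof.
rewrite hat_entry // (bigD1 (@Ordinal 8 0 isT)) //= mulr1 big1 ?addr0 //.
by case=> [[|[|[|[|[|[|[|[|//]]]]]]]] ?] //= _; rewrite ?oppr0 mulr0.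
Qed.

Lemma hat_x3E x : hat_x3 h1 h2 x = vsval x o0 o2.
Proof.
rewrite hat_entry // (bigD1 (@Ordinal 8 2 isT)) //= mulr1 big1 ?addr0 //.
by case=> [[|[|[|[|[|[|[|[|//]]]]]]]] ?] //= _; rewrite ?oppr0 mulr0.
Qed.

Lemma hat_y1E x : hat_y1 h1 h2 x = vsval x o1 o0.
Proof.
rewrite hat_entry // (bigD1 (@Ordinal 8 3 isT)) //= mulr1 big1 ?addr0 //.
by case=> [[|[|[|[|[|[|[|[|//]]]]]]]] ?] //= _; rewrite ?oppr0 mulr0.
Qed.

Lemma hat_y3E x : hat_y3 h1 h2 x = - vsval x o2 o0.
Proof.
rewrite hat_entry // (bigD1 (@Ordinal 8 5 isT)) //= mulrN1 big1 ?addr0 ?opprK //.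
by case=> [[|[|[|[|[|[|[|[|//]]]]]]]] ?] //= _; rewrite mulr0.
Qed.

End Hats.

(** * Characteristic 2: the quadratic component *)

Definition odd_unit i j (ij : oddix i (+) oddix j) : sl12_odd K :=
  Subvs (etrans (congr1 (fun b => u i j \in sl12_gr K b) (esym ij))
                (sl12_gr_unit i j)).

Lemma sl12_odd_sum (x : sl12_odd K) :
  x = vsval (vsval x) o0 o1 *: @odd_unit o0 o1 isT
    + vsval (vsval x) o0 o2 *: @odd_unit o0 o2 isT
    + vsval (vsval x) o1 o0 *: @odd_unit o1 o0 isT
    + vsval (vsval x) o2 o0 *: @odd_unit o2 o0 isT.
Proof.
have x0 i j : oddix i (+) oddix j != true -> vsval (vsval x) i j = 0.
  exact: (sl12_grP _ _ (subvsP x)).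
apply: val_inj; rewrite /= [LHS]sl12_sum_unit !sum_ord3.
rewrite (x0 o0 o0) // (x0 o1 o1) // (x0 o1 o2) // (x0 o2 o1) // (x0 o2 o2) //.
by rewrite !scale0r !(add0r, addr0).
Qed.

(** In characteristic 2 all signs are 1 and an alternating form is symmetric, so the cyclic identity
    turns into the cocycle identity. *)
Lemma cocycle2_super c q : 2%N \in [pchar K] -> is_cocycle2 c q -> super_cocycle c.
Proof.
move=> K2 [[c_bil c_alt] _ c_jac _].
have sg n : (-1) ^+ n = 1 :> K by rewrite (oppr_pchar2 K2) expr1n.
have [c1 c2] := c_bil.
have cD x y z : c x (y + z) = c x y + c x z by rewrite -[y]scale1r c1 !scale1r.
have cDl x y z : c (y + z) x = c y x + c z x by rewrite -[y]scale1r c2 !scale1r.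
have c_sym x y : c x y = c y x.
  have := c_alt (x + y); rewrite cD !cDl !c_alt add0r addr0 => /eqP.
  by rewrite addr_eq0 (oppr_pchar2 K2) => /eqP.
split=> // [a b x y _ _|a b x y z x_a y_b].
  by rewrite sg mul1r (oppr_pchar2 K2).
(* The bracket is symmetric in characteristic 2; as z may be inhomogeneous, it is split before
   [sl12_skew] applies. *)
have br_sym : sl12_br z x = {[x, z]}.
  rewrite -brE; have [z0 z0_ev [z1 z1_odd ->]] := sl12_gr_dec z.
  rewrite br_addr br_addl.
  rewrite (sl12_skew z0_ev x_a) (sl12_skew z1_odd x_a) !sg !scale1r.
  by rewrite -!scaleN1r (oppr_pchar2 K2) !scale1r.
have := c_jac x y z; rewrite br_sym -!brE => /eqP.
rewrite -addrA addr_eq0 (oppr_pchar2 K2) => /eqP->.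
by rewrite sg mul1r (oppr_pchar2 K2) c_sym [c y _]c_sym.
Qed.

Lemma H2_char2_span (K2 : 2%N \in [pchar K]) (h1 h2 : sl) :
  is_diag_mx (vsval h1) -> is_diag_mx (vsval h2) ->
  basis_of fullv (sl12_seq h1 h2) ->
  forall h : H2_char2 K, exists a1 a3 b1 b3 : K,
    h = a1 *: wedge_sqr_class K2 (hat_x1 h1 h2)
      + a3 *: wedge_sqr_class K2 (hat_x3 h1 h2)
      + b1 *: wedge_sqr_class K2 (hat_y1 h1 h2)
      + b3 *: wedge_sqr_class K2 (hat_y3 h1 h2).
Proof.
move=> h1_diag h2_diag bas h; rewrite -[h]subquot_classK.
case: (repr h) => [[c q] zP].
have /asboolP /= cq := zP; have [_ [qZ qD] _ _] := cq.
have [f fE] := super_cocycle_cobdry (cocycle2_super K2 cq).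
(* Subtracting the coboundary of [f] leaves the pair (0, r). *)
pose r (x : sl12_odd K) : K := q x - f (sl12_sq x).
have sqZ (k : K) (x : sl12_odd K) : sl12_sq (k *: x) = k ^+ 2 *: sl12_sq x.
  by apply: val_inj; rewrite /= -scalemxAl -scalemxAr scalerA.
(* The square of an odd matrix polarizes to xy + yx, the superbracket, so [r] inherits polar form
   0. *)
have sqD (x y : sl12_odd K) :
    sl12_sq (x + y) = sl12_sq x + sl12_sq y + {[vsval x, vsval y]}.
  apply: val_inj.
  rewrite /= (vsval_br_homog (subvsP x) (subvsP y)) /= expr1 scaleN1r opprK.
  by rewrite mulmxDl !mulmxDr [X in _ + X = _]addrC addrACA.
have rZ (k : K) (x : sl12_odd K) : r (k *: x) = k ^+ 2 * r x.
  by rewrite /r qZ sqZ formZ mulrBr.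
have rD (x y : sl12_odd K) : r (x + y) = r x + r y.
  by rewrite /r qD sqD !formD fE; ring.
pose a1 := r (@odd_unit o0 o1 isT); pose a3 := r (@odd_unit o0 o2 isT).
pose b1 := r (@odd_unit o1 o0 isT); pose b3 := r (@odd_unit o2 o0 isT).
(* Being additive with r(k x) = k^2 r(x), [r] is fixed by its values on the four odd units. *)
have rE (x : sl12_odd K) :
    r x = a1 * hat_x1 h1 h2 (vsval x) ^+ 2 + a3 * hat_x3 h1 h2 (vsval x) ^+ 2
      + b1 * hat_y1 h1 h2 (vsval x) ^+ 2 + b3 * hat_y3 h1 h2 (vsval x) ^+ 2.
  rewrite hat_x1E // hat_x3E // hat_y1E // hat_y3E // {1}[x]sl12_odd_sum.
  by rewrite !rD !rZ /a1 /a3 /b1 /b3; ring.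
exists a1, a3, b1, b3.
rewrite /wedge_sqr_class !subquot_classZ -!subquot_classD.
apply/subquot_classE/asboolP; exists f.
(* The two terms in the bilinear part of [wedge v v] are equal and cancel. *)
have wedge0 (v : sl -> K) x y : v x * v y + v y * v x = 0.
  by rewrite [v y * _]mulrC addrr_pchar2.
pose u1 := hat_x1 h1 h2; pose u3 := hat_x3 h1 h2.
pose v1 := hat_y1 h1 h2; pose v3 := hat_y3 h1 h2.
split=> [x y|x].
  rewrite -[LHS]/(c x y - (a1 * (u1 x * u1 y + u1 y * u1 x)
    + a3 * (u3 x * u3 y + u3 y * u3 x) + b1 * (v1 x * v1 y + v1 y * v1 x)
    + b3 * (v3 x * v3 y + v3 y * v3 x))).
  by rewrite !wedge0 !mulr0 !addr0 subr0 fE brE.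
pose t := vsval x; rewrite -[LHS]/(q x - (a1 * (u1 t * u1 t)
  + a3 * (u3 t * u3 t) + b1 * (v1 t * v1 t) + b3 * (v3 t * v3 t))).
by rewrite -!expr2 -rE /r opprB addrC subrK.
Qed.

End Sl12Cohomology.

Theorem lemma2p8 (K : closedFieldType) (p : nat) (charKp : p \in [pchar K]) :
  (p != 2%N -> (forall h : H1 K, h = 0) /\ (forall h : H2 K, h = 0)) /\
  (forall p2 : p = 2%N,
    let K2 := pchar_eq2 p2 charKp in
    (forall h : H1 K, h = 0) /\
    (forall h1 h2 : sl12 K,
       is_diag_mx (vsval h1) -> is_diag_mx (vsval h2) ->
       basis_of fullv (sl12_seq h1 h2) ->
       forall h : H2_char2 K, exists a1 a3 b1 b3 : K,
         h = a1 *: wedge_sqr_class K2 (hat_x1 h1 h2)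
           + a3 *: wedge_sqr_class K2 (hat_x3 h1 h2)
           + b1 *: wedge_sqr_class K2 (hat_y1 h1 h2)
           + b3 *: wedge_sqr_class K2 (hat_y3 h1 h2))).
Proof.
split=> [_|p2 K2]; split; try exact: H1_eq0; first exact: H2_eq0.
exact: H2_char2_span.
Qed.
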